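(* For any $\beta>0$, $$\lim_{n\to\infty}\frac1n\log\big(Z_n^{\beta,231}\big)=2\log\big(1+e^\beta\big)-\beta-\frac1\beta\int_{e^{-\beta}}^{e^\beta}\frac{\log y}{1+y}\,\mathrm dy,$$ $$\lim_{n\to\infty}\frac1n\log\big(Z_n^{\beta,321}\big)=\frac2\beta\int_{e^{-\beta/2}}^{e^{\beta/2}}\frac{\log(1+y)}{y}\,\mathrm dy.$$ For $\beta\le0$, $\lim_{n\to\infty}\frac1n\log(Z_n^{\beta,231})=\lim_{n\to\infty}\frac1n\log(Z_n^{\beta,321})=\log4$.
   Context: For $\beta\in\mathbb R$, $n\ge1$ and $\alpha\in\{231,321\}$, $Z_n^{\beta,\alpha}:=\sum_\sigma e^{\frac\beta n\mathrm{inv}(\sigma)}$, where the sum is over all $\alpha$-avoiding permutations $\sigma$ of $\{1,\dots,n\}$ and $\mathrm{inv}(\sigma)$ is the number of inversions of $\sigma$. A permutation avoids $321$ if it has no decreasing subsequence of length $3$; it avoids $231$ if there are no $i<j<k$ with $\sigma(k)<\sigma(i)<\sigma(j)$. *)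

(* Defs.v *)
From HB Require Import structures.
From mathcomp Require Import all_boot all_order all_algebra all_fingroup.
From mathcomp Require Import all_classical all_reals all_analysis.
Set Implicit Arguments.
Unset Strict Implicit.
Unset Printing Implicit Defensive.
Import Order.TTheory GRing.Theory Num.Theory.
Import numFieldNormedType.Exports.
Local Open Scope ring_scope.

Inductive pattern := pat231 | pat321.

(* Permutations of {1, ..., n} are encoded as permutations of {0, ..., n - 1}. *)
Definition inversions (n : nat) (s : 'S_n) : nat :=
  #|[set p : 'I_n * 'I_n | (p.1 < p.2)%N && (s p.2 < s p.1)%N]|.

Definition occurs_at (a : pattern) (n : nat) (s : 'S_n) (i j k : 'I_n) : bool :=
  [&& (i < j)%N, (j < k)%N &
    match a with
    | pat231 => (s k < s i)%N && (s i < s j)%N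
    | pat321 => (s k < s j)%N && (s j < s i)%N
    end].

Definition avoids (a : pattern) (n : nat) (s : 'S_n) : bool :=
  ~~ [exists i, exists j, exists k, occurs_at a s i j k].

Definition partition_function (R : realType) (beta : R) (a : pattern)
    (n : nat) : R :=
  \sum_(s : 'S_n | avoids a s) expR (beta / n%:R * (inversions s)%:R).

(* Main.v *)
Require Import Defs.
From HB Require Import structures.
From mathcomp Require Import all_boot all_order all_algebra all_fingroup.
From mathcomp Require Import all_classical all_reals all_analysis.
From mathcomp Require Import zify ring lra.
Import Order.TTheory GRing.Theory Num.Theory.
Import numFieldNormedType.Exports.
Set Implicit Arguments.
Unset Strict Implicit.
Unset Printing Implicit Defensive.
Local Open Scope classical_set_scope.
Local Open Scope ring_scope.

(** For both patterns the partition function is squeezed between two sums over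
    lattice paths, one with and one without a positivity constraint; the sum
    without constraint factorises, and the logarithm of the product is a
    Riemann sum of [softplus u = ln (1 + e^u)].  Throughout [q = e^(beta / n)].

    Pattern 321.  A 321-avoiding permutation is increasing on its records and
    increasing off them, so it is determined by the set A of their positions
    and the set B of their values, and it has (sum of B) - (sum of A)
    inversions.  Centring both sums at n/2 and summing over all pairs of
    subsets of {0, ..., n - 1} gives the upper bound [sum_avoids321_le],
    [prod_i (1 + q^(i - n/2)) (1 + q^(n/2 - i))].  Conversely, a pair (A, B) of
    equal cardinality in which the elements of A are met no later than those of
    B yields a 321-avoiding permutation of n + 1 letters with at least that many
    inversions ([excursion_sum_le_avoids321]).

    Pattern 231.  Inserting a last value shows that these permutations
    correspond to sequences d of natural numbers with [d_1 = 0] and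
    [d_(i+1) <= d_i + 1], the inversion number being the sum of d
    ([sum_avoids231]).  Such a sequence is a Dyck path of length 2n and the sum
    is an area.  Dropping positivity gives the upper bound
    [prod_(s < 2n) (1 + q^(s - n))] ([walk231_ub]).  Reading a Dyck path two
    steps at a time compares it with the same pairs (A, B) as above, with q
    replaced by q^2 ([excursion_sum_le_walk231]); this is why the limit for 231
    at beta is the limit for 321 at 2 beta.

    For beta >= 0 the positivity constraint is almost free.  Rotating a closed
    path so that it starts at its minimum makes it positive and does not
    decrease its area, so the constraint costs a factor n + 1 at most
    ([bridge_sum_le_excursion_sum]).  The condition |A| = |B| costs another
    factor n + 1, by Cauchy-Schwarz and the symmetry i -> n - 1 - i
    ([bridge_sum_ge]).  So both bounds have the same exponential rate
    ([cvg_ln_partition_function]), and the two integrals of the theorem are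
    obtained from the integral of softplus by the substitution [y = e^u] and,
    for 231, an integration by parts.

    For beta <= 0 the partition function is at most its value at 0, of rate
    ln 4.  It is also not much smaller: its logarithm is convex in beta, so it
    lies above the secants through 0 and a small t > 0, and the slope of those
    is O(t) because softplus is symmetric to first order around 0
    ([partition_function_tangent], [ln_partition_function_le_quadratic]). *)

(** * Words, bridges and excursions *)
Section Excursions.
Implicit Types (t : bool * bool) (x : seq (bool * bool)) (h : int).

(** The two bits of the i-th letter say whether i lies in A and whether i lies in
    B; a word of length n thus stands for a pair of subsets of {0, ..., n - 1},
    and its prefix heights compare how far A and B have been enumerated. *)
Definition step t : int := (t.1 : nat)%:Z - (t.2 : nat)%:Z.

Definition height x : int := \sum_(t <- x) step t.

Fixpoint area h x : int := if x is t :: x' then h + area (h + step t) x' else 0.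

Fixpoint excursion h x : bool :=
  if x is t :: x' then (0 <= h) && excursion (h + step t) x' else h == 0.

Lemma height_cat x y : height (x ++ y) = height x + height y.
Proof. exact: big_cat. Qed.

Lemma height_cons t x : height (t :: x) = step t + height x.
Proof. exact: big_cons. Qed.

Lemma area_cat h x y : area h (x ++ y) = area h x + area (h + height x) y.
Proof.
elim: x h => [|t x IH] h /=; first by rewrite /height big_nil addr0 add0r.
by rewrite IH height_cons !addrA.
Qed.

Lemma area_shift h x : area h x = area 0 x + h *+ size x.
Proof.
suff E h' d : area (h' + d) x = area h' x + d *+ size x by rewrite -{1}[h]add0r E.
elim: x h' => [|t x IH] h' /=; first by rewrite mulr0n addr0.
by rewrite (addrAC h' d (step t)) IH mulrS; ring.
Qed.

Lemma excursionP h x :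
  reflect (h + height x = 0 /\ forall i, (i <= size x)%N -> 0 <= h + height (take i x))
          (excursion h x).
Proof.
elim: x h => [|t x IH] h /=.
  rewrite /height big_nil addr0; apply: (iffP eqP) => [->|[] //].
  by split=> // i _; rewrite big_nil.
apply: (iffP andP) => [[h0 /IH[ht hx]]|[ht hx]]; split.
- by rewrite height_cons addrA.
- case=> [_|i /hx]; first by rewrite /= /height big_nil addr0.
  by rewrite -addrA -height_cons.
- by have := hx 0%N isT; rewrite /= /height big_nil addr0.
- apply/IH; split; first by rewrite -addrA -height_cons.
  by move=> i ix; rewrite -addrA -height_cons; apply: (hx i.+1).
Qed.

(** Cut the word at a minimum of its height and exchange the two pieces.  All
    heights are then measured from that minimum, so they become nonnegative;
    as the minimum is at most the starting height 0, this raises every height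
    and hence the area. *)
Lemma exists_rot_excursion x : height x = 0 ->
  exists2 k, (k <= size x)%N & excursion 0 (rot k x) /\ area 0 x <= area 0 (rot k x).
Proof.
move=> hx.
pose H (k : 'I_(size x).+1) := height (take k x).
case: (@arg_minP _ _ _ ord0 xpredT H isT) => k _ Hmin.
have lek : (k <= size x)%N by rewrite -ltnS.
have {}Hmin i : (i <= size x)%N -> height (take k x) <= height (take i x).
  by rewrite -ltnS => ix; apply: (Hmin (Ordinal ix) isT).
exists k => //; set u := take k x; set v := drop k x.
have xE : x = u ++ v by rewrite cat_take_drop.
have hv : height v = - height u.
  by apply/eqP; rewrite -addr_eq0 addrC -height_cat -xE hx.
have hu : height u <= 0.
  by rewrite (le_trans (Hmin 0%N isT)) // take0 /height big_nil.
split.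
  apply/excursionP; rewrite add0r /rot -/u -/v; split.
    by rewrite height_cat hv addNr.
  move=> i; rewrite size_cat addnC -size_cat -xE => ix; rewrite add0r take_cat.
  case: ltnP => iv.
    have := Hmin (k + i)%N; rewrite takeD height_cat -/u -/v lerDl; apply.
    by move: iv; rewrite size_drop ltn_subRL => /ltnW.
  rewrite height_cat hv addrC subr_ge0 take_takel.
    by apply: Hmin; apply: leq_trans (leq_subr _ _) ix.
  by rewrite leq_subLR; move: ix; rewrite size_drop in iv *; lia.
rewrite /rot -/u -/v [in leLHS]xE !area_cat !add0r hv.
rewrite (area_shift (height u)) (area_shift (- height u)).
suff : height u *+ size v <= - height u *+ size u by lra.
by rewrite (@le_trans _ _ 0) // ?mulrn_wle0 // mulrn_wge0 // oppr_ge0.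
Qed.

End Excursions.

Section ExcursionSum.
Variable (R : realType).
Implicit Types (w : R).

Definition bridge_sum w n : R :=
  \sum_(x : n.-tuple (bool * bool) | height x == 0) expR (w * (area 0 x)%:~R).

Definition excursion_sum w n (h : int) : R :=
  \sum_(x : n.-tuple (bool * bool) | excursion h x) expR (w * (area h x)%:~R).

(** A word is recovered from its rotation and the place of the cut, and there
    are n + 1 possible cuts. *)
Lemma bridge_sum_le_excursion_sum w n : 0 <= w ->
  bridge_sum w n <= n.+1%:R * excursion_sum w n 0.
Proof.
move=> w0; have rotP (x : n.-tuple (bool * bool)) : exists k : 'I_n.+1, height x == 0 ->
    excursion 0 (rot k x) && (area 0 x <= area 0 (rot k x)).
  have [/eqP/exists_rot_excursion[k]|_] := boolP (height x == 0); last by exists ord0.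
  by rewrite size_tuple -ltnS => kn [e a]; exists (Ordinal kn); rewrite e.
have [k kP] := choice rotP.
pose f (x : n.-tuple (bool * bool)) : 'I_n.+1 * n.-tuple (bool * bool) :=
  (k x, [tuple of rot (k x) x]).
have f_inj : injective f.
  by move=> x y [kxy xy]; apply/val_inj/(@rot_inj (k x)) => /=; rewrite xy kxy.
rewrite /bridge_sum /excursion_sum.
pose F (p : 'I_n.+1 * n.-tuple (bool * bool)) : R := expR (w * (area 0 p.2)%:~R).
apply: (@le_trans _ _ (\sum_(x : n.-tuple (bool * bool) | height x == 0) F (f x))).
  apply: ler_sum => x /kP/andP[_ ax]; rewrite ler_expR ler_wpM2l // ler_int //.
rewrite -(big_imset F (h := f) (A := [pred x | height (tval x) == 0])) /=; last exact: in2W.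
rewrite [leRHS](_ : _ = \sum_(p : 'I_n.+1 * n.-tuple (bool * bool) | excursion 0 p.2) F p).
  rewrite big_mkcond [leRHS]big_mkcond; apply: ler_sum => p _.
  case: ifP => [/imsetP[x]|_]; last by case: ifP; rewrite ?expR_ge0.
  by move=> /kP/andP[ex _] ->; rewrite /= ex.
rewrite -(pair_big xpredT (fun x : n.-tuple _ => excursion 0 x)
  (fun _ x => expR (w * (area 0 (tval x))%:~R))) /=.
by rewrite sumr_const card_ord mulr_natl.
Qed.

Lemma sum_tupleS (T : finType) n (F : seq T -> R) :
  \sum_(x : n.+1.-tuple T) F x = \sum_(t : T) \sum_(x : n.-tuple T) F (t :: x).
Proof.
rewrite pair_bigA /= (reindex (fun p : T * n.-tuple T => [tuple of p.1 :: p.2])) //=.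
exists (fun x => (thead x, [tuple of behead x])) => [[t x] _|x _] /=.
  by congr (_, _); apply: val_inj.
by rewrite -tuple_eta.
Qed.

Lemma sum_tuple0 (T : finType) (F : seq T -> R) : \sum_(x : 0.-tuple T) F x = F [::].
Proof. by rewrite (big_pred1 [tuple]) // => x; apply/esym/eqP/tuple0. Qed.

Lemma excursion_sum0 w h : excursion_sum w 0 h = (h == 0)%:R.
Proof.
rewrite /excursion_sum big_mkcond.
rewrite (sum_tuple0 (fun x => if excursion h x then expR (w * (area h x)%:~R) else 0)) /=.
by case: eqP; rewrite // mulr0 expR0.
Qed.

(** Transfer equation for the first letter: it raises the height in one way,
    lowers it in one way and keeps it in two ways. *)
Lemma excursion_sumS w n h : excursion_sum w n.+1 h =
  (0 <= h)%R%:R * expR (w * h%:~R) *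
    (excursion_sum w n (h + 1) + excursion_sum w n h *+ 2 + excursion_sum w n (h - 1)).
Proof.
transitivity (\sum_t (0 <= h)%R%:R * expR (w * h%:~R) * excursion_sum w n (h + step t)).
  rewrite /excursion_sum big_mkcond /=.
  rewrite (sum_tupleS _ (fun x => if excursion h x then expR (w * (area h x)%:~R) else 0)).
  apply: eq_bigr => t _ /=; rewrite -big_mkcondr big_distrr /=.
  case: (0 <= h) => /=; last by rewrite big_pred0 // big1 // => x _; rewrite !mul0r.
  apply: eq_bigr => x _; rewrite mul1r -expRD; congr expR.
  by rewrite rmorphD /= mulrDr.
rewrite -big_distrr /=; congr (_ * _).
rewrite -(pair_bigA _ (fun a b : bool => excursion_sum w n (h + step (a, b)))) /= !big_bool.
have s11 : step (true, true) = 0 by []. have s10 : step (true, false) = 1 by [].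
have s01 : step (false, true) = -1 by []. have s00 : step (false, false) = 0 by [].
by rewrite s11 s10 s01 s00 addr0 mulr2n /=; ring.
Qed.

Lemma excursion_sum_neg w n h : h < 0 -> excursion_sum w n h = 0.
Proof.
case: n => [|n] h0; first by rewrite excursion_sum0 lt_eqF.
by rewrite excursion_sumS leNgt h0 !mul0r.
Qed.

Lemma excursion_sum_high w n h : n%:Z < h -> excursion_sum w n h = 0.
Proof.
elim: n h => [|n IH] h hn; first by rewrite excursion_sum0 gt_eqF.
by rewrite excursion_sumS !IH ?mul0rn ?addr0 ?mulr0 //; lia.
Qed.

End ExcursionSum.

Lemma areaE h (x : seq (bool * bool)) : area h x =
  h *+ size x + \sum_(j < size x) ((size x)%:Z - j.+1%:Z) * step (nth (false, false) x j).
Proof.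
elim: x h => [|t x IH] h /=; first by rewrite big_ord0 addr0.
rewrite IH big_ord_recl /= mulrnDl mulrS -!addrA; congr (_ + (_ + _)).
rewrite -[step t *+ _]mulr_natl natz. congr (_ * _ + _).
lia.
Qed.

Lemma height_tupleE n (x : n.-tuple (bool * bool)) : height x = \sum_(j < n) step (tnth x j).
Proof. by rewrite /height big_tuple. Qed.

(** On a bridge the area is linear in the letters: it is the sum of B minus the
    sum of A. *)
Lemma area_bridge n (x : n.-tuple (bool * bool)) : height x = 0 ->
  area 0 x = \sum_(j < n) - (j%:Z * step (tnth x j)).
Proof.
move=> hx; rewrite areaE mul0rn add0r size_tuple.
transitivity (\sum_(j < n) ((n%:Z - 1) * step (tnth x j) - j%:Z * step (tnth x j))).
  by apply: eq_bigr => j _; rewrite -tnth_nth -mulrBl; congr (_ * _); lia.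
by rewrite big_split /= -big_distrr /= -height_tupleE hx mulr0 add0r.
Qed.

(** * The number of bridges, weighted by area *)
Section PairsOfSets.
Variable n : nat.
Implicit Types A B : {set 'I_n}.

Definition word_of_sets (p : {set 'I_n} * {set 'I_n}) : n.-tuple (bool * bool) :=
  [tuple (j \in p.1, j \in p.2) | j < n].

Lemma word_of_sets_bij : bijective word_of_sets.
Proof.
exists (fun x => ([set j | (tnth x j).1]%SET, [set j | (tnth x j).2]%SET)) => [[A B]|x].
  by congr (_, _); apply/setP => j; rewrite inE tnth_mktuple.
by apply: eq_from_tnth => j; rewrite tnth_mktuple !inE -surjective_pairing.
Qed.

Lemma height_word_of_sets A B : height (word_of_sets (A, B)) = #|A|%:Z - #|B|%:Z.
Proof.
rewrite height_tupleE.
under eq_bigr do rewrite tnth_mktuple /step /=.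
have cardE (C : {set 'I_n}) : \sum_j ((j \in C) : nat)%:Z = #|C|%:Z.
  rewrite -sum1_card (big_morph Posz PoszD (erefl _)) [RHS]big_mkcond.
  by apply: eq_bigr => j _; case: (j \in C).
by rewrite sumrB !cardE.
Qed.

End PairsOfSets.

Section BridgeSum.
Variable (R : realType).

(** Cauchy-Schwarz against the constant family, obtained from the variance. *)
Lemma sqr_sum_le m (e : 'I_m.+1 -> R) : (\sum_k e k) ^+ 2 <= m.+1%:R * \sum_k e k ^+ 2.
Proof.
set S := \sum_k e k; pose mu := S / m.+1%:R.
have m0 : (m.+1%:R : R) != 0 by rewrite pnatr_eq0.
have SE : S = mu * m.+1%:R by rewrite /mu divfK.
have : \sum_k (e k * (2 * mu) - mu ^+ 2) <= \sum_k e k ^+ 2.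
  by apply: ler_sum => k _; have := sqr_ge0 (e k - mu); nra.
rewrite sumrB -big_distrl /= -/S sumr_const card_ord -mulr_natl => h.
rewrite (le_trans _ (ler_wpM2l (ler0n R m.+1) h)) // SE.
by rewrite le_eqVlt; apply/orP; left; apply/eqP; ring.
Qed.

(** Because a bridge has |A| = |B|, the area may be measured from the centre
    (n - 1)/2 of the indices, and the sum over bridges becomes the sum over k
    of [e_k(y) e_k(1/y)], where [e_k] is the k-th elementary symmetric
    polynomial.  The centred weights y are exchanged with their inverses by the
    reversal of indices, so every term is the square of [e_k(y)], while the sum
    of all the [e_k(y)] is the product of the [1 + y_j]. *)
Lemma bridge_sum_ge w n : \prod_(j < n) (1 + expR (w * ((n%:R - 1) / 2 - j%:R))) ^+ 2 <=
  n.+1%:R * bridge_sum w n :> R.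
Proof.
pose y (j : 'I_n) : R := expR (w * ((n%:R - 1) / 2 - j%:R)).
pose Y (A : {set 'I_n}) : R := \prod_(j in A) y j.
pose e (k : 'I_n.+1) : R := \sum_(A : {set 'I_n} | inord #|A| == k) Y A.
have cardA (A : {set 'I_n}) : (#|A| < n.+1)%N by rewrite ltnS -[leqRHS](card_ord n) max_card.
(* [inord] makes a summation index of a cardinality, which is at most n. *)
have prodE : \prod_(j < n) (1 + y j) = \sum_k e k.
  under eq_bigr do rewrite addrC.
  rewrite bigA_distr /= (partition_big (fun A : {set 'I_n} => inord #|A| : 'I_n.+1) xpredT) //=.
  by apply: eq_bigr => k _; apply: eq_bigr => A _; rewrite /Y [RHS]big_mkcond.
have revE k : e k = \sum_(A : {set 'I_n} | inord #|A| == k) (Y A)^-1.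
  have revK : involutive (fun A : {set 'I_n} => (@rev_ord n @: A)%SET).
    move=> A; rewrite -imset_comp -[RHS]imset_id; apply: eq_imset => j /=; exact: rev_ordK.
  rewrite /e (reindex_inj (inv_inj revK)) /=; apply: eq_big => [A|A _].
    by rewrite card_imset //; exact: rev_ord_inj.
  rewrite /Y big_imset /=; last by apply: in2W; exact: rev_ord_inj.
  rewrite -prodfV; apply: eq_bigr => j _; rewrite -expRN /y; congr expR.
  by rewrite natrB // -natr1; field.
rewrite prodrXl prodE (le_trans (sqr_sum_le _)) // ler_wpM2l //.
rewrite le_eqVlt; apply/orP; left; apply/eqP.
rewrite /bridge_sum (reindex _ (onW_bij _ (@word_of_sets_bij n))) /=.
transitivity (\sum_(p : {set 'I_n} * {set 'I_n} | #|p.1| == #|p.2|) Y p.1 / Y p.2).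
  rewrite (partition_big (fun p : {set 'I_n} * {set 'I_n} => inord #|p.1| : 'I_n.+1) xpredT) //=.
  apply: eq_bigr => k _; rewrite expr2 {2}revE /e big_distrlr /= pair_big /=.
  apply: eq_bigl => -[A B] /=; apply/andP/andP => -[/eqP h1 /eqP h2].
    split; rewrite ?h1 //; apply/eqP.
    by have := h1; rewrite -h2 => /(congr1 val) /=; rewrite !inordK.
  by rewrite -h1 h2.
apply: eq_big => [[A B]|[A B] /= /eqP AB].
  by rewrite height_word_of_sets subr_eq0 eqz_nat.
set W := word_of_sets (A, B); have hW : height W = 0 by rewrite height_word_of_sets AB subrr.
rewrite (area_bridge hW) /Y; pose c : R := (n%:R - 1) / 2.
have -> : w * (\sum_(j < n) - (j%:Z * step (tnth W j)))%:~R =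
    \sum_(j < n) w * (c - j%:R) * (step (tnth W j))%:~R.
  have : \sum_(j < n) (step (tnth W j))%:~R = 0 :> R by rewrite -rmorph_sum -height_tupleE hW.
  move=> s0; transitivity (\sum_(j < n) (w * c * (step (tnth W j))%:~R +
      w * (- (j%:Z * step (tnth W j)))%:~R)); last first.
    by apply: eq_bigr => j _; rewrite rmorphN rmorphM /= -pmulrn; ring.
  by rewrite big_split /= -!big_distrr /= s0 mulr0 add0r rmorph_sum.
rewrite expR_sum [\prod_(j in A) _]big_mkcond [\prod_(j in B) _]big_mkcond /= -prodf_div.
apply: eq_bigr => j _.
rewrite tnth_mktuple /step /= /y -/c.
by case: (j \in A); case: (j \in B);
  rewrite /= ?subrr ?subr0 ?sub0r ?mulr0 ?mulr1 ?mulrN1 ?expR0 ?expRN ?divr1 ?mul1r //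
    divff // gt_eqF ?expR_gt0.
Qed.


End BridgeSum.

(** * Removing the last value of a permutation *)
Lemma inversionsE n (s : 'S_n) :
  inversions s = (\sum_(i < n) \sum_(j < n) ((i < j) && (s j < s i)))%N.
Proof.
rewrite /inversions -sum1dep_card pair_bigA /= big_mkcond /=.
by apply: eq_bigr => -[i j] _ /=; case: ifP.
Qed.

Lemma sum_ord_gt n (v : 'I_n.+1) : (\sum_(i < n.+1) (v < i) = n - v)%N.
Proof.
rewrite -(big_mkord xpredT (fun i => (v < i)%N : nat)).
rewrite (@big_cat_nat _ _ _ v.+1) //=.
rewrite big1_seq => [|i]; last by rewrite mem_index_iota ltnS; case: leqP => //; lia.
rewrite (eq_big_nat _ _ (F2 := fun=> 1%N)); last by move=> i /andP[->].
by rewrite sum_nat_const_nat; lia.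
Qed.

Lemma ltn_bump2 h i j : (bump h i < bump h j)%N = (i < j)%N.
Proof. by rewrite !ltnNge leq_bump2. Qed.

Lemma inversions_lift_max n (v : 'I_n.+1) (t : 'S_n) :
  (inversions (lift_perm ord_max v t) = inversions t + (n - v))%N.
Proof.
rewrite !inversionsE (bigD1_ord ord_max) //= [X in (X + _)%N]big1 ?add0n; last first.
  by move=> j _; case: ltnP => //; have := ltn_ord j; lia.
under eq_bigr do rewrite (bigD1_ord ord_max) //=.
rewrite big_split /= addnC; congr (_ + _)%N.
  apply: eq_bigr => i _; apply: eq_bigr => j _.
  by rewrite !lift_perm_lift /= !ltn_bump2.
rewrite -sum_ord_gt (bigD1_ord v) //= ltnn add0n [RHS](reindex_inj (@perm_inj _ t)) /=.
apply: eq_bigr => i _; rewrite lift_perm_lift lift_perm_id /=.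
by rewrite [bump n i](lift_max i) ltn_ord.
Qed.

(** The new last value v completes a 231 pattern exactly when two values above it
    appear in increasing order.  If t avoids 231, its values from the last one
    upwards appear in decreasing order, so v is safe when at most these are
    larger.  Inserted lower, v comes after two increasing larger values: the one
    that was v in t, and the last one of t. *)
Lemma avoids_lift_max n (v : 'I_n.+2) (t : 'S_n.+1) :
  avoids pat231 (lift_perm ord_max v t) = avoids pat231 t && (t ord_max <= v)%N.
Proof.
set s := lift_perm ord_max v t.
have sL i : s (lift ord_max i) = bump v (t i) :> nat by rewrite lift_perm_lift.
have sM : s ord_max = v by rewrite lift_perm_id.
have Lv (i : 'I_n.+1) : lift ord_max i = i :> nat := lift_max i.
apply/idP/idP => [Ns|/andP[Nt le_tv]]; last first.
  apply/existsP => -[i /existsP[j /existsP[k]]] /and4P[ij jk].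
  case: (unliftP ord_max i) ij => [i' ->|->] ij; last first.
    by exfalso; have := ltn_ord j; move: ij jk => /=; lia.
  case: (unliftP ord_max j) ij jk => [j' ->|->] ij jk; last first.
    by exfalso; have := ltn_ord k; move: ij jk => /=; lia.
  case: (unliftP ord_max k) jk => [k' ->|->] jk.
    rewrite !Lv in ij jk; rewrite !sL !ltn_bump2 => ki ij'; case/negP: Nt.
    apply/existsP; exists i'; apply/existsP; exists j'; apply/existsP; exists k'.
    by apply/and4P.
  rewrite sM !sL ltn_bump2 => vi ij'.
  have vi' : (v <= t i')%N by move: vi; rewrite /bump; case: leqP => /=; lia.
  rewrite !Lv in ij.
  have jmax : (j' < (ord_max : 'I_n.+1))%N.
    rewrite ltn_neqAle -ltnS ltn_ord andbT; apply/eqP => /val_inj jE.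
    by move: ij'; rewrite jE; lia.
  case/negP: Nt.
  apply/existsP; exists i'; apply/existsP; exists j'; apply/existsP; exists ord_max.
  apply/and4P; split => //; rewrite ltn_neqAle (leq_trans le_tv) // andbT.
  apply: contraTneq (ltn_trans ij jmax) => /val_inj/perm_inj ->.
  by rewrite ltnn.
apply/andP; split.
  apply: contra Ns => /existsP[i /existsP[j /existsP[k]]] /and4P[ij jk ki ij'].
  apply/existsP; exists (lift ord_max i); apply/existsP; exists (lift ord_max j).
  apply/existsP; exists (lift ord_max k).
  by rewrite /occurs_at !Lv !sL !ltn_bump2; apply/and4P.
rewrite leqNgt; apply: contra Ns => vt.
have vn : (v < n.+1)%N by have := ltn_ord (t ord_max); lia.
pose i := (t^-1)%g (Ordinal vn).
have ti : t i = Ordinal vn by rewrite permKV.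
have imax : (i < (ord_max : 'I_n.+1))%N.
  rewrite ltn_neqAle -ltnS ltn_ord andbT; apply/eqP => /val_inj iE.
  by move: vt; rewrite -iE ti /= ltnn.
apply/existsP; exists (lift ord_max i).
apply/existsP; exists (lift ord_max ord_max); apply/existsP; exists ord_max.
rewrite /occurs_at sM !sL ltn_bump2 !Lv imax ti /= vt andbT.
by rewrite /bump; case: leqP vt => //=; lia.
Qed.

Lemma lift_max_bij n :
  bijective (fun p : 'S_n * 'I_n.+1 => lift_perm ord_max p.2 p.1).
Proof.
apply: inj_card_bij => [[s v] [t w] /= st|].
  have vw : v = w by have := congr1 (fun u : 'S_n.+1 => u ord_max) st; rewrite !lift_perm_id.
  subst w; congr (_, _); apply/permP => i.
  have := congr1 (fun u : 'S_n.+1 => u (lift ord_max i)) st.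
  by rewrite !lift_perm_lift => /lift_inj.
have cS m : #|{: 'S_m}| = m`! by rewrite -card_Sn; apply: eq_card => s; rewrite inE.
by rewrite card_prod !cS card_ord factS mulnC.
Qed.

(** * 231-avoiding permutations as Dyck paths *)
Section Walk.
Variables (R : realType) (q : R).

(** The total weight of the continuations by k values of a permutation in which
    a + 1 places are available for the next value: using the place with h larger
    values creates h inversions and leaves h + 2 places for the one after. *)
Fixpoint walk231 (k a : nat) : R :=
  if k is k'.+1 then \sum_(h < a.+1) q ^+ h * walk231 k' h.+1 else 1.

Lemma sum_avoids231S n (F : nat -> R) :
  \sum_(s : 'S_n.+2 | avoids pat231 s) q ^+ inversions s * F (n.+2 - s ord_max)%N =
  \sum_(t : 'S_n.+1 | avoids pat231 t) q ^+ inversions t *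
     \sum_(h < (n.+1 - t ord_max).+1) q ^+ h * F h.+1.
Proof.
rewrite (reindex _ (onW_bij _ (lift_max_bij n.+1))) /=.
under eq_bigl do rewrite avoids_lift_max.
under eq_bigr do rewrite inversions_lift_max lift_perm_id.
rewrite -(pair_big_dep (@avoids pat231 n.+1) (fun t (v : 'I_n.+2) => (t ord_max <= v)%N)
  (fun t v => q ^+ (inversions t + (n.+1 - v)) * F (n.+2 - v)%N)) /=.
apply: eq_bigr => t _; rewrite big_distrr /=.
rewrite (big_ord_widen n.+2 (fun h => q ^+ inversions t * (q ^+ h * F h.+1))); last lia.
rewrite (reindex_inj rev_ord_inj) /=; apply: eq_big => [h|h _].
  by have := ltn_ord h; have := ltn_ord (t ord_max); lia.
rewrite exprD mulrA; congr (_ * q ^+ _ * F _); have := ltn_ord h; lia.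
Qed.

(** Unfolds the one-step recursion from the permutation of one letter, whose next
    value has two available places. *)
Lemma sum_avoids231 n :
  \sum_(s : 'S_n.+1 | avoids pat231 s) q ^+ inversions s = walk231 n 1.
Proof.
suff H m k : \sum_(s : 'S_k.+1 | avoids pat231 s)
    q ^+ inversions s * walk231 m (k.+1 - s ord_max) = walk231 (m + k) 1.
  by rewrite -(H 0%N); apply: eq_bigr => s _; rewrite mulr1.
elim: k m => [|k IH] m; last by rewrite addnS -addSn -IH sum_avoids231S.
have E (s : 'S_1) : s = 1%g by apply/permP => i; rewrite !ord1.
rewrite (big_pred1 (1%g : 'S_1)) => [|s]; last first.
  rewrite [RHS]eq_sym [s]E eqxx; apply/existsP => -[i /existsP[j /existsP[k]]].
  by rewrite !ord1.
rewrite perm1 subn0 addn0 (_ : inversions _ = 0)%N ?mul1r //.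
by rewrite inversionsE !big_ord1.
Qed.

End Walk.

Section WalkBounds.
Variables (R : realType) (x : R).
Local Notation q := (expR x).

(** These two equations read a Dyck path one step at a time: a is the current
    height, k the number of up-steps to come, and an up-step from height a has
    weight [q ^+ a]. *)
Lemma walk231SS k a : walk231 q k.+1 a.+1 = walk231 q k.+1 a + q ^+ a.+1 * walk231 q k a.+2.
Proof. by rewrite /= big_ord_recr. Qed.

Lemma walk231S0 k : walk231 q k.+1 0 = walk231 q k 1.
Proof. by rewrite /= big_ord1 expr0 mul1r. Qed.

Lemma walk231_ge0 k a : 0 <= walk231 q k a.
Proof.
elim: k a => [|k IH] a //=; apply: sumr_ge0 => h _.
by rewrite mulr_ge0 // exprn_ge0 // expR_ge0.
Qed.

(** If the path may become negative, its remaining 2k + a steps contribute, up to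
    the factor in front, a weight that depends only on the position of the
    up-steps; summing over all subsets of positions gives the product.  The
    exponent [k (c - k)] accounts for replacing heights by positions counted
    from the end, and the right-hand side then satisfies the recursion of
    [walk231], with an inequality at height 0. *)
Lemma walk231_ub c k a : walk231 q k a <=
  expR (x * (k%:R * (c - k%:R))) * \prod_(s < 2 * k + a) (1 + expR (x * (s%:R - c))).
Proof.
have P0 m : 0 <= \prod_(s < m) (1 + expR (x * (s%:R - c))).
  by apply: prodr_ge0 => s _; rewrite addr_ge0 ?expR_ge0.
elim: k a => [|k IHk] a.
  rewrite mul0r mulr0 expR0 mul1r /=; elim: (2 * 0 + a)%N => [|m IH].
    by rewrite big_ord0.
  by rewrite big_ord_recr /= (le_trans IH) // ler_peMr ?lerDl ?expR_ge0 ?P0.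
elim: a => [|a IHa].
  rewrite walk231S0 (le_trans (IHk 1%N)) //.
  rewrite (_ : 2 * k.+1 + 0 = (2 * k + 1).+1)%N; last lia.
  rewrite big_ord_recr /= [leRHS]mulrCA [leRHS]mulrC ler_wpM2r ?P0 //.
  rewrite [leRHS]mulrDr mulr1 -expRD; set y := expR (_ + _).
  suff -> : expR (x * (k%:R * (c - k%:R))) = y by rewrite lerDr expR_ge0.
  by congr expR; rewrite natrD natrM -natr1; ring.
rewrite walk231SS (_ : 2 * k.+1 + a.+1 = (2 * k.+1 + a).+1)%N; last lia.
rewrite big_ord_recr /= [X in _ <= _ * X]mulrDr mulr1 [leRHS]mulrDr; apply: lerD => //.
have -> : (2 * k.+1 + a = 2 * k + a.+2)%N by lia.
rewrite (le_trans (ler_wpM2l _ (IHk a.+2))) ?exprn_ge0 ?expR_ge0 //.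
rewrite mulrA [leRHS]mulrCA [leRHS]mulrC ler_wpM2r ?P0 // -expRM_natl -!expRD ler_expR.
rewrite le_eqVlt; apply/orP; left; apply/eqP.
by rewrite (natrD _ (2 * k)%N) natrM -!natr1; ring.
Qed.

(** The Dyck path is read two steps at a time from an odd height: height 2D + 1
    of the path is height D of the word, and the pairs of steps up-up, up-down,
    down-up and down-down are the four letters.  The factor [q^(D (D + 1))] is a
    potential that turns the weights of up-steps into an area: after this
    correction a pair of steps from height 2D + 1 has weight at least
    [q^(2 D)], the weight of a letter read at height D. *)
Lemma excursion_sum_le_walk231 k D : 0 <= x ->
  excursion_sum (2 * x) (k + D) D%:Z <= expR (x * (D * D.+1)%:R) * walk231 q k (2 * D).+1.
Proof.
move=> x0; move Em: (k + D)%N => m; elim: m k D Em => [|m IH] k D Em.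
  have [-> ->] : k = 0%N /\ D = 0%N by lia.
  by rewrite excursion_sum0 mul0n mulr0 expR0 mulr1.
pose G := excursion_sum (2 * x) m; pose E n := expR (x * n%:R).
have ED i j : E (i + j)%N = E i * E j by rewrite /E natrD mulrDr expRD.
have Eq i : q ^+ i = E i by rewrite -expRM_natl mulrC.
have E0 i : 0 <= E i := expR_ge0 _.
have up : G (D%:Z + 1) <= E (D.+1 * D.+2)%N *
    (if k is k'.+2 then walk231 q k' (2 * D.+1).+1 else 0).
  case: k Em => [|[|k]] Em; rewrite ?mulr0.
  - by rewrite /G excursion_sum_high //; lia.
  - by rewrite /G excursion_sum_high //; lia.
  - have -> : D%:Z + 1 = D.+1%:Z by lia.
    by apply: (IH k D.+1); lia.
have level : G D%:Z <= E (D * D.+1)%N * (if k is k'.+1 then walk231 q k' (2 * D).+1 else 0).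
  case: k Em {up} => [|k] Em; rewrite ?mulr0.
    by rewrite /G excursion_sum_high //; lia.
  by apply: (IH k D); lia.
have down : G (D%:Z - 1) <=
    (if D is D'.+1 then E (D' * D'.+1)%N * walk231 q k (2 * D').+1 else 0).
  case: D Em {up level} => [|D] Em; first by rewrite /G excursion_sum_neg.
  have -> : D.+1%:Z - 1 = D%:Z by lia.
  by apply: (IH k D); lia.
(* Each of the four first letters matches one pair of steps, by induction. *)
have {up level down} : excursion_sum (2 * x) m.+1 D <= E (2 * D)%N *
   (E (D.+1 * D.+2)%N * (if k is k'.+2 then walk231 q k' (2 * D.+1).+1 else 0) +
    E (D * D.+1)%N * (if k is k'.+1 then walk231 q k' (2 * D).+1 else 0) *+ 2 +
    (if D is D'.+1 then E (D' * D'.+1)%N * walk231 q k (2 * D').+1 else 0)).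
  rewrite excursion_sumS mul1r {1}/E natrM mulrA [x * 2]mulrC.
  by rewrite ler_wpM2l ?expR_ge0 // !lerD // lerMn2r level orbT.
move/le_trans; apply; rewrite -/(E _).
(* The common potential factors out; what remains is two steps of the recursion. *)
set U := (if k is _.+2 then _ else _); set L := (if k is _.+1 then _ else _).
pose W j : R := if D is D'.+1 then walk231 q j (2 * D').+1 else 0.
rewrite [leLHS](_ : _ = E (D * D.+1)%N * (E (4 * D + 2)%N * U + E (2 * D)%N * L *+ 2 + W k)).
  rewrite ler_wpM2l //; have Emono i j : (i <= j)%N -> E i <= E j.
    by move=> ij; rewrite ler_expR ler_wpM2l // ler_nat.
  rewrite /U /L; case: k {Em U L} => [|k].
    by rewrite !mulr0 mul0rn !add0r /W; case: (D) => [|D'] /=; rewrite ?ler01 ?lexx.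
  have tail : walk231 q k (2 * D).+1 +
      E (2 * D + 2)%N * (if k is k'.+1 then walk231 q k' (2 * D.+1).+1 else 0)
      <= walk231 q k (2 * D).+2.
    case: k => [|k]; first by rewrite mulr0 addr0.
    by rewrite [leRHS]walk231SS Eq addn2 mulnS.
  have head : E (2 * D)%N * walk231 q k (2 * D).+1 + W k.+1 <= walk231 q k.+1 (2 * D).
    rewrite /W; case: (D) => [|D']; first by rewrite walk231S0 /E mulr0 expR0 mul1r addr0.
    by rewrite mulnS add2n [leRHS]walk231SS Eq addrC.
  rewrite [leRHS]walk231SS Eq.
  set V := (if k is k'.+1 then _ else _) in tail *.
  have V0 : 0 <= V by rewrite /V; case: (k) => // k'; exact: walk231_ge0.
  apply: le_trans (lerD head (ler_wpM2l (E0 _) tail)).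
  rewrite mulrDr mulrA -ED mulr2n.
  have := ler_wpM2r V0 (Emono (4 * D + 2) ((2 * D).+1 + (2 * D + 2)) _)%N.
  have := ler_wpM2r (walk231_ge0 k (2 * D).+1) (Emono (2 * D) (2 * D).+1 _)%N.
  move=> /(_ (leqnSn _)) h1 /(_ ltac:(lia)) h2; lra.
rewrite !mulrDr !mulrA -!ED; congr (_ + _ + _).
- by congr (E _ * _); lia.
- by rewrite addnC.
- rewrite /W; case: (D) => [|D']; rewrite ?mulr0 //.
  by rewrite mulrA -ED; congr (E _ * _); lia.
Qed.

End WalkBounds.

(** * 321-avoiding permutations as unions of two increasing sequences *)
Lemma inversions_sum n (s : 'S_n) :
  inversions s = (\sum_(i < n) #|[set j : 'I_n | (i < j)%N && (s j < s i)%N]%SET|)%N.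
Proof.
rewrite inversionsE; apply: eq_bigr => i _; rewrite -sum1_card [RHS]big_mkcond /=.
by apply: eq_bigr => j _; rewrite inE; case: (_ && _).
Qed.

Lemma card_ord_lt n m : (m <= n)%N -> #|[set j : 'I_n | (j < m)%N]%SET| = m.
Proof.
move=> mn; rewrite -sum1_card big_mkcond /=.
under eq_bigr do rewrite inE.
by rewrite -big_mkcond /= -(big_ord_widen n (fun=> 1%N) mn) sum1_card card_ord.
Qed.

Lemma card_perm_lt n (s : 'S_n) m : (m <= n)%N -> #|[set j : 'I_n | (s j < m)%N]%SET| = m.
Proof.
move=> mn; rewrite -[RHS](card_ord_lt mn) -[LHS](card_imset _ (@perm_inj _ s)).
apply: eq_card => j; rewrite inE; apply/imsetP/idP => [[i] + ->|jm].
  by rewrite inE.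
by exists (s^-1%g j); rewrite ?inE permKV.
Qed.

Lemma card_smaller n (s : 'S_n) (i : 'I_n) :
  (#|[set j : 'I_n | (i < j) && (s j < s i)]%SET| + #|[set j : 'I_n | (j < i) && (s j < s i)]%SET|
   = s i)%N.
Proof.
rewrite -[RHS](@card_perm_lt n s (s i)); last exact: ltnW.
rewrite -(cardsID [set j : 'I_n | (i < j)%N]%SET [set j : 'I_n | (s j < s i)%N]%SET).
congr (_ + _)%N; apply: eq_card => j; rewrite !inE; first by rewrite andbC.
by rewrite -leqNgt; case: ltngtP => //= /val_inj ->; rewrite ltnn.
Qed.

(** Of the s i values smaller than s i, at most i occur before position i. *)
Lemma card_inversions_ge n (s : 'S_n) (i : 'I_n) :
  (s i <= i + #|[set j : 'I_n | (i < j) && (s j < s i)]%SET|)%N.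
Proof.
rewrite -{1}card_smaller addnC leq_add2r -[leqRHS](@card_ord_lt n i); last exact: ltnW.
by apply/subset_leq_card/fintype.subsetP => j; rewrite !inE => /andP[].
Qed.

Lemma inversions_ge n (s : 'S_n) (A : {set 'I_n}) :
  (\sum_(i in A) s i <= \sum_(i in A) i + inversions s)%N.
Proof.
rewrite inversions_sum [X in (_ + X)%N](bigID (mem A)) /= addnA.
apply: leq_trans (leq_addr _ _); rewrite -big_split /=.
by apply: leq_sum => i _; apply: card_inversions_ge.
Qed.

Section IncreasingOn.
Variable n : nat.
Implicit Types (s t : 'S_n) (A : {set 'I_n}).

Definition increasing_on s A :=
  forall i j : 'I_n, i \in A -> j \in A -> (i < j)%N -> (s i < s j)%N.

Lemma increasing_onE s A (i j : 'I_n) : increasing_on s A -> i \in A -> j \in A ->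
  (s i < s j)%N = (i < j)%N.
Proof.
move=> sA iA jA; apply/idP/idP; last exact: sA.
case: (ltngtP i j) => // [/(sA _ _ jA iA)|/val_inj ->]; last by rewrite ltnn.
by case: ltngtP.
Qed.

(** An increasing map preserves ranks; this is what lets the two sets A and B
    determine the permutation and lets ballot conditions be compared with
    excedances. *)
Lemma card_rank s A (i : 'I_n) : increasing_on s A -> i \in A ->
  #|[set j in s @: A | (j < s i)%N]%SET| = #|[set j in A | (j < i)%N]%SET|.
Proof.
move=> sA iA; rewrite -[RHS](card_imset _ (@perm_inj _ s)); apply: eq_card => j.
rewrite !inE; apply/andP/imsetP => [[/imsetP[k kA ->]]|[k]].
  by rewrite (increasing_onE sA) // => ki; exists k; rewrite ?inE ?kA.
by rewrite inE => /andP[kA ki] ->; rewrite imset_f // (increasing_onE sA).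
Qed.

Lemma increasing_on_inj s t A :
  increasing_on s A -> increasing_on t A -> (s @: A = t @: A)%SET -> {in A, s =1 t}.
Proof.
move=> sA tA st i iA; apply/val_inj/eqP; rewrite eqn_leq.
suff W u v : increasing_on u A -> increasing_on v A -> (u @: A = v @: A)%SET ->
  (u i <= v i)%N by rewrite !W.
move=> {}sA {}tA {}st.
rewrite leqNgt; apply/negP => ti.
have := card_rank sA iA; rewrite -(card_rank tA iA) st => /eqP.
rewrite gtn_eqF // proper_card //; apply/properP; split.
  by apply/fintype.subsetP => j; rewrite !inE => /andP[-> /ltn_trans]; apply.
by exists (v i); rewrite !inE imset_f //= ltnn.
Qed.

Lemma imsetC s A : (s @: (~: A) = ~: (s @: A))%SET.
Proof.
apply/setP => j; rewrite inE -[j](permKV s) !(mem_imset _ _ (@perm_inj _ s)).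
by rewrite inE.
Qed.

(** Two of any three positions lie on the same side of A. *)
Lemma increasing_avoids321 s A : increasing_on s A -> increasing_on s (~: A)%SET ->
  avoids pat321 s.
Proof.
move=> sA sC; apply/existsP => -[i /existsP[j /existsP[k /and4P[ij jk kj ji]]]].
have W (B : {set 'I_n}) (a b : 'I_n) : increasing_on s B -> (a < b)%N -> (s b < s a)%N ->
    ~~ ((a \in B) && (b \in B)).
  move=> sB ab; apply: contraTN => /andP[aB bB]; rewrite -leqNgt ltnW //; exact: sB.
have ik := ltn_trans ij jk; have ki := ltn_trans kj ji.
have := W _ _ _ sA ij ji; have := W _ _ _ sA jk kj; have := W _ _ _ sA ik ki.
have := W _ _ _ sC ij ji; have := W _ _ _ sC jk kj; have := W _ _ _ sC ik ki.
by rewrite !inE; case: (i \in A); case: (j \in A); case: (k \in A).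
Qed.

(** List A before its complement and B before its complement, each in increasing
    order, and match the two lists. *)
Lemma exists_increasing_on (A B : {set 'I_n}) : #|A| = #|B| ->
  exists s, [/\ (s @: A = B)%SET, increasing_on s A & increasing_on s (~: A)%SET].
Proof.
move=> AB; have ABC : #|(~: A)%SET| = #|(~: B)%SET|.
  by rewrite [LHS]cardsCs [RHS]cardsCs !finset.setCK AB.
pose E (C : {set 'I_n}) : seq 'I_n := enum C ++ enum (~: C)%SET.
have memE C i : i \in E C by rewrite mem_cat !mem_enum inE orbN.
have uniqE C : uniq (E C).
  rewrite cat_uniq !enum_uniq andbT /=; apply/hasPn => i.
  by rewrite !mem_enum inE.
have sizeE C : size (E C) = n by rewrite size_cat -!cardE cardsC card_ord.
pose f i := nth i (E B) (index i (E A)).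
have idx i : (index i (E A) < size (E B))%N by rewrite sizeE -[ltnRHS](sizeE A) index_mem.
have f_inj : injective f.
  move=> i j /eqP; rewrite /f (set_nth_default j) // nth_uniq // => /eqP.
  by move/(congr1 (nth i (E A))); rewrite !nth_index // => ->.
have fA i : i \in A -> f i = nth i (enum B) (index i (enum A)).
  move=> iA; rewrite /f index_cat mem_enum iA nth_cat.
  by rewrite -cardE -AB cardE index_mem mem_enum iA.
have fC i : i \in (~: A)%SET ->
    f i = nth i (enum (~: B)%SET) (index i (enum (~: A)%SET)).
  move=> iC; have iA : i \notin A by move: iC; rewrite inE.
  rewrite /f index_cat mem_enum (negPf iA) nth_cat -!cardE AB.
  by rewrite ltnNge leq_addr addKn.
have sorted_enum (C : {set 'I_n}) : sorted (fun i j : 'I_n => (i < j)%N) (enum C).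
  rewrite /enum_mem; apply: sorted_filter; first by move=> ? ? ?; exact: ltn_trans.
  by have := iota_ltn_sorted 0 n; rewrite -fintype.val_enum_ord sorted_map -enumT.
have mono (C D : {set 'I_n}) (i j : 'I_n) : #|C| = #|D| -> i \in C -> j \in C -> (i < j)%N ->
    (nth i (enum D) (index i (enum C)) < nth j (enum D) (index j (enum C)))%N.
  move=> CD iC jC ij; have iD : (index i (enum C) < size (enum D))%N.
    by rewrite -cardE -CD cardE index_mem mem_enum.
  have jD : (index j (enum C) < size (enum D))%N by rewrite -cardE -CD cardE index_mem mem_enum.
  rewrite (set_nth_default j) //; apply: (sorted_ltn_nth _ j (sorted_enum D)) => //.
    by move=> ? ? ?; exact: ltn_trans.
  rewrite ltnNge; apply: contraTN ij; rewrite leq_eqVlt -leqNgt => /orP[/eqP e|ji].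
    by move/(congr1 (nth i (enum C))): e; rewrite !nth_index ?mem_enum // => ->.
  apply: ltnW; apply: (sorted_ltn_index _ (sorted_enum C)); rewrite ?mem_enum //.
  by move=> ? ? ?; exact: ltn_trans.
exists (perm f_inj); split.
- apply/eqP; rewrite eqEcard card_imset ?AB ?leqnn ?andbT; last exact: perm_inj.
  apply/fintype.subsetP => j /imsetP[i iA ->]; rewrite permE fA // -mem_enum mem_nth //.
  by rewrite -cardE -AB cardE index_mem mem_enum.
- by move=> i j iA jA ij; rewrite !permE !fA //; apply: mono.
- by move=> i j iA jA ij; rewrite !permE !fC //; apply: mono.
Qed.

Definition records s : {set 'I_n} :=
  [set i : 'I_n | [forall j : 'I_n, (j < i)%N ==> (s j < s i)%N]]%SET.

Lemma records_increasing s : increasing_on s (records s).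
Proof. by move=> i j _; rewrite inE => /forallP/(_ i)/implyP. Qed.

(** A descent between two non-records would be extended to the left, by a larger
    earlier value, to a 321 pattern. *)
Lemma avoids321_increasing s : avoids pat321 s -> increasing_on s (~: records s)%SET.
Proof.
move=> av i j; rewrite !inE negb_forall => /existsP[k]; rewrite negb_imply -leqNgt.
move=> /andP[ki ik] _ ij; rewrite ltnNge; apply: contra av => ji.
apply/existsP; exists k; apply/existsP; exists i; apply/existsP; exists j.
apply/and4P; split => //; rewrite ltn_neqAle.
  by rewrite ji andbT; apply: contraTneq ij => /val_inj/perm_inj ->; rewrite ltnn.
by rewrite ik andbT; apply: contraTneq ki => /val_inj/perm_inj ->; rewrite ltnn.
Qed.

(** Only a record can be the larger end of an inversion.  Every value placed
    before a record i is smaller than s i, so exactly s i - i smaller values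
    come after it. *)
Lemma avoids321_inversions s : avoids pat321 s ->
  (inversions s + \sum_(i in records s) i = \sum_(i in records s) s i)%N.
Proof.
move=> av; rewrite inversions_sum (bigID (mem (records s))) /= [X in (_ + X + _)%N]big1 => [|i ir].
  rewrite addn0 -big_split /=; apply: eq_bigr => i; rewrite inE => /forallP ri.
  rewrite -[RHS]card_smaller; congr (_ + _)%N; rewrite -[LHS](@card_ord_lt n i); last exact: ltnW.
  by apply: eq_card => j; rewrite !inE; have := ri j; case: ltnP => //= _ ->.
apply: eq_card0 => j; rewrite !inE; apply/negP => /andP[ij ji].
have iC : i \in (~: records s)%SET by rewrite inE.
case: (boolP (j \in (~: records s)%SET)) => [jC|].
  by have := avoids321_increasing av iC jC ij; case: ltngtP ji.
by rewrite !inE negbK => /forallP/(_ i); rewrite ij /=; case: ltngtP ji.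
Qed.

End IncreasingOn.

(** If A is enumerated strictly ahead of B, the increasing matching moves A
    strictly up, and it then moves the complement of A weakly down.  Hence A
    can be read off the permutation, which makes the construction injective. *)
Lemma excedances_of_ballot n (s : 'S_n) (A : {set 'I_n}) :
  increasing_on s A -> increasing_on s (~: A)%SET ->
  (forall i : 'I_n, #|[set j in s @: A | (j <= i)%N]%SET| <= #|[set j in A | (j < i)%N]%SET|)%N ->
  A = [set i : 'I_n | (i < s i)%N]%SET.
Proof.
move=> sA sC ballot; apply/setP => i; rewrite inE; apply/idP/idP => [iA|].
  rewrite ltnNge; apply/negP => si; have := ballot i; rewrite -(card_rank sA iA) leqNgt.
  case/negP; apply/proper_card/properP; split.
    by apply/fintype.subsetP => j; rewrite !inE => /andP[-> /ltnW/leq_trans]; apply.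
  by exists (s i); rewrite !inE imset_f // ltnn.
apply: contraTT => iA; have iC : i \in (~: A)%SET by rewrite inE.
rewrite -leqNgt leqNgt; apply/negP => si; have := card_rank sC iC; rewrite imsetC.
have split_card (C : {set 'I_n}) (P : pred 'I_n) :
    (#|[set j in C | P j]%SET| + #|[set j in ~: C | P j]%SET| = #|[set j | P j]%SET|)%N.
  rewrite -[RHS](cardsID C); congr (_ + _)%N; apply: eq_card => j; rewrite !inE //.
  by rewrite andbC.
have : (#|[set j in ~: (s @: A) | (j < i.+1)%N]%SET| <=
    #|[set j in ~: (s @: A) | (j < s i)%N]%SET|)%N.
  apply/subset_leq_card/fintype.subsetP => j; rewrite !inE => /andP[-> ji] /=.
  by apply: leq_ltn_trans si; rewrite -ltnS.
have : (#|[set j in s @: A | (j < i.+1)%N]%SET| <= #|[set j in A | (j < i)%N]%SET|)%N := ballot i.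
have := split_card (s @: A)%SET (fun j => (j < i.+1)%N); have := split_card A (fun j => (j < i)%N).
rewrite /= (card_ord_lt (ltn_ord i)) (card_ord_lt (ltnW (ltn_ord i))). lia.
Qed.

(** * Bounds for the pattern 321 *)
Section Bounds321.
Variables (R : realType) (x : R).

(** Since A and B have the same cardinality, the inversion number does not change
    when both sums are centred at the same c. *)
Lemma sum_avoids321_le (c : R) n :
  \sum_(s : 'S_n | avoids pat321 s) expR (x * (inversions s)%:R) <=
  \prod_(j < n) (1 + expR (x * (j%:R - c))) * \prod_(j < n) (1 + expR (- (x * (j%:R - c)))).
Proof.
pose y (j : 'I_n) : R := expR (x * (j%:R - c)).
pose z (j : 'I_n) : R := expR (- (x * (j%:R - c))).
pose F (p : {set 'I_n} * {set 'I_n}) : R := (\prod_(j in p.2) y j) * (\prod_(j in p.1) z j).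
have prodE (u : 'I_n -> R) : \prod_(j < n) (1 + u j) = \sum_(A : {set 'I_n}) \prod_(j in A) u j.
  under eq_bigr do rewrite addrC.
  by rewrite bigA_distr; apply: eq_bigr => A _; rewrite [RHS]big_mkcond.
have -> : \prod_(j < n) (1 + y j) * \prod_(j < n) (1 + z j) = \sum_p F p.
  rewrite !prodE mulrC big_distrlr /= pair_bigA /=; apply: eq_bigr => p _.
  by rewrite mulrC.
pose g (s : 'S_n) := (records s, (s @: records s)%SET).
have g_inj : {in [pred s | avoids pat321 s] &, injective g}.
  move=> s t /avoids321_increasing sC /avoids321_increasing tC [rst st].
  have tA : increasing_on t (records s) by rewrite rst; exact: records_increasing.
  rewrite -rst in st tC.
  apply/permP => i; case: (boolP (i \in records s)) => ir.
    exact: (increasing_on_inj (records_increasing (s := s)) tA st).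
  apply: (increasing_on_inj sC tC); last by rewrite inE.
  by rewrite !imsetC st.
have FE s : avoids pat321 s -> expR (x * (inversions s)%:R) = F (g s).
  move=> av; rewrite /F /= big_imset /=; last by apply: in2W; exact: perm_inj.
  rewrite -!expR_sum -expRD; congr expR.
  rewrite -big_split /=; under eq_bigr do rewrite -mulrN -mulrDr.
  rewrite -big_distrr /=; congr (_ * _).
  have -> : (inversions s)%:R = (\sum_(i in records s) s i)%:R - (\sum_(i in records s) i)%:R :> R.
    by rewrite -(avoids321_inversions av) natrD addrK.
  by rewrite !natr_sum -sumrB; apply: eq_bigr => i _; ring.
rewrite (eq_bigr (fun s => F (g s)) FE) -(big_imset F g_inj) /=.
rewrite [leRHS]big_mkcond [leLHS]big_mkcond; apply: ler_sum => p _; case: ifP => // _.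
by rewrite mulr_ge0 // prodr_ge0 // => j _; exact: expR_ge0.
Qed.

End Bounds321.

Section WordPermutation.
Variable n : nat.
Implicit Type w : n.-tuple (bool * bool).

(** The sets A and B of a word, inside an index set with one more point: the
    values are shifted up by one, so that the weak inequality between the
    enumerations of A and B given by an excursion becomes strict. *)
Definition rises w : {set 'I_n.+1} := [set i : 'I_n.+1 | (nth (false, false) w i).1]%SET.

Definition falls w : {set 'I_n.+1} :=
  [set i : 'I_n.+1 | (0 < i)%N && (nth (false, false) w i.-1).2]%SET.

Lemma rises_falls_inj w w' : rises w = rises w' -> falls w = falls w' -> w = w'.
Proof.
move=> /setP rE /setP fE; apply: eq_from_tnth => j.
have := rE (widen_ord (leqnSn n) j); have := fE (lift ord0 j).
rewrite !inE /= !(tnth_nth (false, false)).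
by case: nth => [a b]; case: nth => [a' b'] /= -> ->.
Qed.

Lemma sum_rises (f : nat -> nat) w :
  (\sum_(i in rises w) f i = \sum_(j < n) (tnth w j).1 * f j)%N.
Proof.
(* The letter read at the extra index n is the default one. *)
rewrite big_mkcond big_ord_recr /= !inE nth_default ?size_tuple // addn0.
by apply: eq_bigr => j _; rewrite inE (tnth_nth (false, false)) /=;
  case: (nth _ _ _).1; rewrite ?mul1n.
Qed.

Lemma sum_falls (f : nat -> nat) w :
  (\sum_(i in falls w) f i = \sum_(j < n) (tnth w j).2 * f j.+1)%N.
Proof.
rewrite big_mkcond big_ord_recl /= !inE add0n.
by apply: eq_bigr => j _; rewrite inE (tnth_nth (false, false)) /=;
  case: (nth _ _ _).2; rewrite ?mul1n.
Qed.

Lemma height_take w m : (m <= n)%N -> height (take m w) =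
  (\sum_(j < n) (tnth w j).1 * (j < m))%:Z - (\sum_(j < n) (tnth w j).2 * (j < m))%:Z.
Proof.
move=> mn; rewrite !(big_morph Posz PoszD (erefl _)) -sumrB /height.
rewrite (big_nth (false, false)) size_take size_tuple big_mkord.
have -> : (if (m < n)%N then m else n) = m by case: ltngtP mn.
rewrite (big_ord_widen n (fun j => step (nth (false, false) (take m w) j)) mn) big_mkcond /=.
apply: eq_bigr => j _; case: ifP => jm; last by rewrite !muln0 subrr.
by rewrite nth_take // !muln1 (tnth_nth (false, false)).
Qed.

Lemma exists_perm_of_excursion w : excursion 0 w ->
  exists s : 'S_n.+1, [/\ avoids pat321 s, rises w = [set i : 'I_n.+1 | (i < s i)%N]%SET,
    falls w = (s @: rises w)%SET & area 0 w <= (inversions s)%:Z].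
Proof.
move=> ew; have [hw hpos] := excursionP _ _ ew; rewrite add0r in hw.
have card_sum (C : {set 'I_n.+1}) (P : pred nat) :
    #|[set j in C | P j]%SET| = (\sum_(j in C) (P j : nat))%N.
  rewrite -sum1_card big_mkcond [RHS]big_mkcond /=; apply: eq_bigr => j _.
  by rewrite inE; case: (_ \in _); case: (P j).
have ballot (i : 'I_n.+1) : (#|[set j in falls w | (j <= i)%N]%SET| <=
    #|[set j in rises w | (j < i)%N]%SET|)%N.
  rewrite (card_sum _ (fun j => (j <= i)%N)) (card_sum _ (fun j => (j < i)%N)).
  rewrite (sum_falls (fun j => (j <= i)%N)) (sum_rises (fun j => (j < i)%N)).
  by have := hpos i; rewrite size_tuple add0r height_take -1?ltnS // => /(_ (ltn_ord i)); lia.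
have AB : #|rises w| = #|falls w|.
  rewrite -!sum1_card (sum_rises (fun=> 1%N)) (sum_falls (fun=> 1%N)).
  have := height_take w (leqnn n); rewrite -{1}(size_tuple w) take_size hw.
  under eq_bigr do rewrite ltn_ord. under [X in _ - X%:Z]eq_bigr do rewrite ltn_ord.
  by move/esym/eqP; rewrite subr_eq0 eqz_nat => /eqP.
have [s [sAB sA sC]] := exists_increasing_on AB; exists s; split => //.
- exact: increasing_avoids321 sA sC.
- by apply: excedances_of_ballot; rewrite ?sAB.
have := inversions_ge s (rises w).
have -> : (\sum_(i in rises w) s i = \sum_(i in falls w) i)%N.
  by rewrite -sAB big_imset //=; apply: in2W; exact: perm_inj.
rewrite (sum_rises id) (sum_falls id) (area_bridge hw).
have -> : \sum_(j < n) - (j%:Z * step (tnth w j)) =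
    (\sum_(j < n) (tnth w j).2 * j)%:Z - (\sum_(j < n) (tnth w j).1 * j)%:Z.
  rewrite !(big_morph Posz PoszD (erefl _)) -sumrB; apply: eq_bigr => j _.
  by rewrite /step !PoszM; ring.
have : (\sum_(j < n) (tnth w j).2 * j <= \sum_(j < n) (tnth w j).2 * j.+1)%N.
  by apply: leq_sum => j _; rewrite leq_mul.
lia.
Qed.

Lemma excursion_sum_le_avoids321 (R : realType) (x : R) : 0 <= x ->
  excursion_sum x n 0 <= \sum_(s : 'S_n.+1 | avoids pat321 s) expR (x * (inversions s)%:R).
Proof.
move=> x0; have H w : exists s : 'S_n.+1, excursion 0 w -> [/\ avoids pat321 s,
    rises w = [set i : 'I_n.+1 | (i < s i)%N]%SET,
    falls w = (s @: rises w)%SET & area 0 w <= (inversions s)%:Z].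
  by case: (boolP (excursion 0 w)) => [/exists_perm_of_excursion[s]|_]; [exists s|exists 1%g].
have [g gP] := choice H.
have g_inj : {in [pred w : n.-tuple _ | excursion 0 (tval w)] &, injective g}.
  move=> w w' /gP[_ r f _] /gP[_ r' f' _] gE.
  by apply: rises_falls_inj; rewrite ?f ?f' r r' gE.
pose F (s : 'S_n.+1) : R := expR (x * (inversions s)%:R).
apply: (@le_trans _ _ (\sum_(w : n.-tuple (bool * bool) | excursion 0 w) F (g w))).
  apply: ler_sum => w /gP[_ _ _ aw]; rewrite ler_expR ler_wpM2l //.
  by rewrite -[leRHS]/((inversions (g w))%:Z%:~R) ler_int.
rewrite -(big_imset F g_inj) big_mkcond [leRHS]big_mkcond; apply: ler_sum => s _ /=.
case: ifP => [/imsetP[w /gP[av _ _ _] ->]|_]; first by rewrite av.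
by case: ifP => // _; exact: expR_ge0.
Qed.

End WordPermutation.

(** * Riemann sums of softplus *)
Section Softplus.
Variable R : realType.
Implicit Types (u g : R).

Definition softplus u : R := ln (1 + expR u).

Definition softplus_sum g n : R := \sum_(i < n) softplus (g * (i%:R / n%:R - 2^-1)).

Lemma onePexpR_gt0 u : 0 < 1 + expR u.
Proof. by rewrite addr_gt0 ?expR_gt0. Qed.

Lemma expR_softplus u : expR (softplus u) = 1 + expR u.
Proof. by rewrite lnK // posrE onePexpR_gt0. Qed.

Lemma prod_onePexpR n (v : 'I_n -> R) :
  \prod_i (1 + expR (v i)) = expR (\sum_i softplus (v i)).
Proof. by rewrite expR_sum; apply: eq_bigr => i _; rewrite expR_softplus. Qed.

Lemma softplusN u : softplus (- u) = softplus u - u.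
Proof.
apply: expR_inj; rewrite expRD !expR_softplus mulrDl mul1r -expRD subrr expR0.
by rewrite addrC.
Qed.

Lemma softplus_ge0 u : 0 <= softplus u.
Proof. by rewrite ln_ge0 // lerDl expR_ge0. Qed.

Lemma ler_softplus : {homo softplus : u v / u <= v}.
Proof. by move=> u v uv; rewrite ler_ln ?posrE ?onePexpR_gt0 // lerD2l ler_expR. Qed.

(** The point is the slope 1/2 at the origin, which cancels in sums that are
    symmetric around 0. *)
Lemma softplus_le_quadratic u : u <= 2^-1 -> softplus u <= ln 2 + u / 2 + u ^+ 2.
Proof.
move=> u2; have u1 : 0 < 1 - u by lra.
have eu : expR u <= 1 + u + 2 * u ^+ 2.
  have := expR_ge1Dx (- u); rewrite expRN => h.
  have : expR u * (1 - u) <= 1 by rewrite -ler_pdivlMl ?expR_gt0 // mulr1.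
  by have := expR_ge0 u => e0 {h} h; nra.
have -> : softplus u = ln 2 + ln (1 + (expR u - 1) / 2).
  rewrite -lnM ?posrE; [|lra|by have := expR_gt0 u; lra].
  by congr ln; lra.
have := @le_ln1Dx R ((expR u - 1) / 2); have := expR_gt0 u => e0 /(_ ltac:(lra)); lra.
Qed.

Lemma sum_centered n : (0 < n)%N -> \sum_(i < n) (i%:R / n%:R - 2^-1) = - 2^-1 :> R.
Proof.
move=> n0; rewrite sumrB sumr_const card_ord -mulr_suml -natr_sum.
have -> : (\sum_(i < n) i = 'C(n, 2))%N by rewrite -(big_mkord xpredT id) bin2_sum.
have : ('C(n, 2)%:R * 2 + n%:R = n%:R * n%:R :> R).
  rewrite -!natrM -natrD; congr (_%:R); rewrite bin2 -divn2.
  by case: n n0 => // n _ /=; rewrite divnK ?dvdn2 ?oddM /=; [lia|case: odd].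
have nR : (n%:R : R) != 0 by rewrite pnatr_eq0 -lt0n.
move=> h; rewrite -mulr_natr (_ : _%:R = (n%:R * n%:R - n%:R) / 2); first by field.
by rewrite -h; field.
Qed.

Lemma softplus_sum_opp g n : (0 < n)%N ->
  \sum_(i < n) softplus (- (g * (i%:R / n%:R - 2^-1))) = softplus_sum g n + g / 2.
Proof.
move=> n0; under eq_bigr do rewrite softplusN.
by rewrite sumrB -mulr_sumr sum_centered // mulrN opprK.
Qed.

Lemma softplus_sum0 n : softplus_sum 0 n = n%:R * ln 2.
Proof.
rewrite /softplus_sum; under eq_bigr do rewrite mul0r.
by rewrite sumr_const card_ord /softplus expR0 mulr_natl.
Qed.

Lemma softplus_sum_le_quadratic g n : 0 <= g <= 1 -> (0 < n)%N ->
  softplus_sum g n <= n%:R * (ln 2 + g ^+ 2).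
Proof.
move=> /andP[g0 g1] n0; have nR : (0 : R) < n%:R by rewrite ltr0n.
apply: (@le_trans _ _ (\sum_(i < n) (ln 2 + g * (i%:R / n%:R - 2^-1) / 2 + g ^+ 2))).
  apply: ler_sum => i _; set v : R := _ - _.
  have v0 : - 2^-1 <= v by rewrite lerBrDl subrr divr_ge0.
  have v1 : v <= 2^-1.
    suff : i%:R / n%:R <= 1 :> R by rewrite /v; lra.
    by rewrite ler_pdivrMr // mul1r ler_nat ltnW.
  have gv : g * v <= 2^-1 by nra.
  apply: (le_trans (softplus_le_quadratic gv)); rewrite lerD2l exprMn.
  by rewrite ler_piMr ?sqr_ge0 //; nra.
rewrite !big_split /= !sumr_const card_ord -mulr_suml -mulr_sumr sum_centered //.
rewrite -[ln 2 *+ n]mulr_natl -[g ^+ 2 *+ n]mulr_natl mulrDr; lra.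
Qed.

(** On each of the n intervals of length g / n the mean value theorem gives the
    increment of H as the length times an intermediate value of the monotone
    function; the sums of left and right end values differ by two terms. *)
Lemma softplus_sum_riemann g (H : R -> R) n : 0 < g -> (0 < n)%N ->
  (forall u, - (g / 2) <= u <= g / 2 -> is_derive u 1 H (softplus u)) ->
  g * softplus_sum g n <= n%:R * (H (g / 2) - H (- (g / 2))) <=
  g * (softplus_sum g n + softplus (g / 2)).
Proof.
move=> g0 n0 dH; have nR : (0 : R) < n%:R by rewrite ltr0n.
pose p i : R := g * (i%:R / n%:R - 2^-1).
have p0 : p 0%N = - (g / 2) by rewrite /p mul0r sub0r mulrN.
have pn : p n = g / 2 by rewrite /p divff ?gt_eqF //; field.
have pS i : p i.+1 - p i = g / n%:R by rewrite /p -natr1; field; rewrite gt_eqF.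
have ple i j : (i <= j)%N -> p i <= p j.
  by move=> ij; rewrite ler_wpM2l ?(ltW g0) // lerD2r ler_pM2r ?invr_gt0 // ler_nat.
have step i : (i < n)%N -> g * softplus (p i) <= n%:R * (H (p i.+1) - H (p i)) <=
    g * softplus (p i.+1).
  move=> i_n; have inI u : p i <= u <= p i.+1 -> - (g / 2) <= u <= g / 2.
    move=> /andP[u0 u1]; rewrite -p0 -pn (le_trans (ple 0%N i isT)) //.
    exact: le_trans (ple _ _ i_n).
  have [||c /itvP cI] := @MVT_segment R H softplus (p i) (p i.+1) (ple _ _ (leqnSn i)).
  - by move=> u /itvP uI; apply/dH/inI; rewrite !uI.
  - apply: derivable_within_continuous => u /itvP uI.
    by have [] : is_derive u 1 H (softplus u) by apply/dH/inI; rewrite !uI.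
  rewrite pS => ->; have -> : n%:R * (softplus c * (g / n%:R)) = g * softplus c.
    by field; rewrite gt_eqF.
  by rewrite !ler_pM2l // !ler_softplus ?cI.
have tele : \sum_(i < n) (H (p i.+1) - H (p i)) = H (g / 2) - H (- (g / 2)).
  by rewrite -(big_mkord xpredT (fun i => H (p i.+1) - H (p i))) telescope_sumr // p0 pn.
rewrite -tele /softplus_sum; apply/andP; split.
  by rewrite !mulr_sumr; apply: ler_sum => i _; have /andP[] := step i (ltn_ord i).
apply: (@le_trans _ _ (\sum_(i < n) g * softplus (p i.+1))).
  by rewrite mulr_sumr; apply: ler_sum => i _; have /andP[] := step i (ltn_ord i).
rewrite -mulr_sumr ler_pM2l // -pn.
have e : \sum_(i < n.+1) softplus (p i) = \sum_(i < n) softplus (p i) + softplus (p n).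
  by rewrite big_ord_recr.
by rewrite -e big_ord_recl /= lerDr softplus_ge0.
Qed.

End Softplus.

(** * Bounds for the logarithm of the partition function *)
Section LogPartition.
Variable R : realType.
Implicit Types (beta g : R) (a : pattern) (n : nat).

(** Reading Dyck paths two steps at a time squares q, which doubles beta. *)
Definition tilt a beta : R := if a is pat231 then 2 * beta else beta.

Lemma avoids_id a n : avoids a (1%g : 'S_n).
Proof.
apply/existsP => -[i /existsP[j /existsP[k]]]; rewrite /occurs_at !perm1.
by case: a => /and3P[ij jk /andP[]]; lia.
Qed.

Lemma partition_function_gt0 beta a n : 0 < partition_function beta a n.
Proof.
rewrite /partition_function (bigD1 1%g) ?avoids_id //= ltr_wpDr ?expR_gt0 //.
by apply: sumr_ge0 => s _; exact: expR_ge0.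
Qed.

Lemma partition_function231 beta n :
  partition_function beta pat231 n.+1 = walk231 (expR (beta / n.+1%:R)) n 1.
Proof.
rewrite -sum_avoids231; apply: eq_bigr => s _.
by rewrite -expRM_natl mulrC.
Qed.

(** A word of length n is weighted here with g / (n + 1), the length of the
    permutation being n + 1.  The centred indices of the word are then those of
    the Riemann sum with n + 1 points except its end point -g/2, which explains
    the correction. *)
Lemma excursion_sum_ge g n : 0 <= g ->
  expR (2 * (softplus_sum g n.+1 - softplus (- (g / 2)))) / n.+1%:R ^+ 2 <=
  excursion_sum (g / n.+1%:R) n 0.
Proof.
move=> g0; set w := g / n.+1%:R; have n0 : (0 : R) < n.+1%:R by rewrite ltr0n.
have w0 : 0 <= w by rewrite divr_ge0 // ltW.
set A := softplus_sum _ _ - _.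
have AE : \prod_(j < n) (1 + expR (w * ((n%:R - 1) / 2 - j%:R))) = expR A.
  rewrite prod_onePexpR; congr expR.
  have := softplus_sum_opp g (ltn0Sn n); rewrite big_ord_recl /= mul0r sub0r mulrN opprK.
  have := softplusN (g / 2) => e1 e2.
  rewrite (_ : A = softplus_sum g n.+1 + g / 2 - softplus (g / 2)); last by rewrite /A e1; ring.
  rewrite -e2 [RHS]addrC addKr; apply: eq_bigr => j _; congr softplus.
  by rewrite /w /bump /= add1n -!natr1; field; rewrite natr1 gt_eqF.
rewrite ler_pdivrMr ?exprn_gt0 // expRM_natl.
have := bridge_sum_ge w n; rewrite prodrXl AE => /le_trans; apply.
rewrite expr2 mulrA [leRHS]mulrC ler_wpM2l ?(ltW n0) // mulrC.
exact: bridge_sum_le_excursion_sum.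
Qed.

Lemma ln_partition_function_ge beta a n : 0 <= beta ->
  2 * (softplus_sum (tilt a beta) n.+1 - softplus (- (tilt a beta / 2))) - 2 * ln n.+1%:R <=
  ln (partition_function beta a n.+1).
Proof.
move=> b0; have n0 : (0 : R) < n.+1%:R by rewrite ltr0n.
have g0 : 0 <= tilt a beta by case: a => //=; rewrite mulr_ge0.
have x0 : 0 <= beta / n.+1%:R by rewrite divr_ge0 // ltW.
set A := 2 * _.
have -> : A - 2 * ln n.+1%:R = ln (expR A / n.+1%:R ^+ 2).
  by rewrite ln_div ?posrE ?expR_gt0 ?exprn_gt0 // expRK lnXn // mulr_natl.
rewrite ler_ln ?posrE ?partition_function_gt0 ?divr_gt0 ?expR_gt0 ?exprn_gt0 //.
apply: (le_trans (excursion_sum_ge n g0)).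
case: a {A} g0 => _; last exact: excursion_sum_le_avoids321.
rewrite partition_function231 -mulrA.
by have := excursion_sum_le_walk231 n 0 x0; rewrite addn0 mul0n mulr0 expR0 mul1r.
Qed.

Lemma ln_partition_function231_le beta n :
  ln (partition_function beta pat231 n.+1) <= softplus_sum (2 * beta) (2 * n.+1).
Proof.
rewrite -[leRHS]expRK ler_ln ?posrE ?expR_gt0 ?partition_function_gt0 //.
rewrite partition_function231 -walk231S0.
apply: (le_trans (walk231_ub _ n.+1%:R _ _)).
rewrite subrr !mulr0 expR0 mul1r addn0 prod_onePexpR le_eqVlt; apply/orP; left.
apply/eqP; congr expR; apply: eq_bigr => s _; congr softplus.
by rewrite natrM; field; rewrite nat1r pnatr_eq0.
Qed.

Lemma ln_partition_function321_le beta n :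
  ln (partition_function beta pat321 n.+1) <= 2 * softplus_sum beta n.+1 + beta / 2.
Proof.
rewrite -[leRHS]expRK ler_ln ?posrE ?expR_gt0 ?partition_function_gt0 //.
apply: (le_trans (sum_avoids321_le _ (n.+1%:R / 2) _)).
rewrite !prod_onePexpR -expRD le_eqVlt; apply/orP; left; apply/eqP; congr expR.
have vE (j : 'I_n.+1) : beta / n.+1%:R * (j%:R - n.+1%:R / 2) = beta * (j%:R / n.+1%:R - 2^-1).
  by field; rewrite nat1r pnatr_eq0.
under eq_bigr do rewrite vE. under [X in _ + X]eq_bigr do rewrite vE.
rewrite -/(softplus_sum beta n.+1) (softplus_sum_opp _ (ltn0Sn n)).
by rewrite mulr_natl mulr2n addrA.
Qed.

End LogPartition.

(** * The integrals *)
Section Integrals.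
Variable R : realType.

(** Integrating from a / 2, left of the interval, makes the primitive
    differentiable at both ends. *)
Lemma exists_primitive (G : R -> R) (a b : R) : 0 < a < b ->
  (forall y, 0 < y -> {for y, continuous G}) ->
  exists2 F : R -> R, (forall y, a <= y <= b -> is_derive y 1 F (G y)) &
    \int[lebesgue_measure]_(y in `[a, b]) G y = F b - F a.
Proof.
move=> /andP[a0 ab] cG; pose c := a / 2; pose d := b + 1.
have c0 : 0 < c by rewrite divr_gt0.
have intG : lebesgue_measure.-integrable `[c, d] (EFin \o G).
  apply: continuous_compact_integrable; first exact: segment_compact.
  apply: continuous_in_subspaceT => y; rewrite inE /= in_itv /= => /andP[cy _].
  by apply: cG; exact: lt_le_trans cy.
pose F y : R := \int[lebesgue_measure]_(t in `[c, y]) G t.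
have dF y : a <= y <= b -> is_derive y 1 F (G y).
  move=> /andP[ay yb].
  have [||||dFy FE] := @continuous_FTC1_closed R G c y d; rewrite /c /d; first lra.
  - exact: intG.
  - lra.
  - by apply: cG; lra.
  by apply: DeriveDef => //; rewrite -derive1E FE.
exists F => //.
have cF y : a <= y <= b -> {for y, continuous F}.
  by move=> /dF dFy; apply/differentiable_continuous/derivable1_diffP; exact: ex_derive.
rewrite /Rintegral (@continuous_FTC2 R G F a b ab) //.
- apply: continuous_in_subspaceT => y; rewrite inE /= in_itv /= => /andP[cy _].
  by apply: cG; exact: lt_le_trans cy.
- split.
  + move=> y; rewrite in_itv /= => /andP[/ltW ay /ltW yb].
    by have [] : is_derive y 1 F (G y) by apply: dF; rewrite ay.
  + by apply: cvg_at_right_filter; apply: cF; rewrite lexx ltW.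
  + by apply: cvg_at_left_filter; apply: cF; rewrite lexx ltW.
- move=> y; rewrite in_itv /= => /andP[/ltW ay /ltW yb].
  by rewrite derive1E; apply: derive_val; apply: dF; rewrite ay.
Qed.

Lemma is_derive_softplus (u : R) : is_derive u 1 (@softplus R) (expR u / (1 + expR u)).
Proof.
have h : is_derive (1 + expR u) 1 (@ln R) (1 + expR u)^-1.
  by apply: is_derive1_ln; exact: onePexpR_gt0.
have k : is_derive u 1 (fun v : R => 1 + expR v) (expR u).
  by have := is_deriveD (is_derive_cst (1 : R) u 1) (is_derive_expR u); rewrite add0r.
by have := @is_derive1_comp R (@ln R) (fun v : R => 1 + expR v) u _ _ h k; rewrite mulrC.
Qed.

Lemma exists_primitive_softplus321 (beta : R) : 0 < beta ->
  exists2 H : R -> R, (forall u, - (beta / 2) <= u <= beta / 2 -> is_derive u 1 H (softplus u)) &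
    \int[lebesgue_measure]_(y in `[expR (- (beta / 2)), expR (beta / 2)]) (ln (1 + y) / y) =
    H (beta / 2) - H (- (beta / 2)).
Proof.
move=> b0; have [||F dF ->] := @exists_primitive (fun y => ln (1 + y) / y)
    (expR (- (beta / 2))) (expR (beta / 2)).
- by rewrite expR_gt0 ltr_expR; lra.
- move=> y y0; apply: cvgM; last by apply: cvgV => //; rewrite gt_eqF.
  apply: continuous_comp; first by apply: cvgD; [exact: cvg_cst|exact: cvg_id].
  by apply: continuous_ln; rewrite addr_gt0.
exists (F \o expR) => // u /andP[u0 u1].
have -> : softplus u = softplus u / expR u * expR u by rewrite divfK // gt_eqF ?expR_gt0.
by apply: is_derive1_comp; apply: dF; rewrite !ler_expR u0.
Qed.

Lemma exists_primitive_softplus231 (beta : R) : 0 < beta ->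
  exists2 H : R -> R, (forall u, - beta <= u <= beta -> is_derive u 1 H (softplus u)) &
    beta * (2 * softplus beta - beta) -
      \int[lebesgue_measure]_(y in `[expR (- beta), expR beta]) (ln y / (1 + y)) =
    H beta - H (- beta).
Proof.
move=> b0; have [||F dF ->] := @exists_primitive (fun y => ln y / (1 + y))
    (expR (- beta)) (expR beta).
- by rewrite expR_gt0 ltr_expR; lra.
- move=> y y0; apply: cvgM; first exact: continuous_ln.
  apply: cvgV; first by rewrite gt_eqF // addr_gt0.
  by apply: cvgD; [exact: cvg_cst|exact: cvg_id].
exists (fun u => u * softplus u - F (expR u)); last by rewrite softplusN; ring.
move=> u /andP[u0 u1].
have dFe : is_derive u 1 (F \o expR) (ln (expR u) / (1 + expR u) * expR u).
  by apply: is_derive1_comp; apply: dF; rewrite !ler_expR u0.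
have dM := is_deriveM (is_derive_id u 1) (is_derive_softplus u).
have := is_deriveB dM dFe; rewrite expRK.
suff -> : u *: (expR u / (1 + expR u)) + softplus u *: 1
  - u / (1 + expR u) * expR u = softplus u by [].
by rewrite /GRing.scale /= mulr1; ring.
Qed.

End Integrals.

(** * The limits *)
Section Limits.
Variable R : realType.

(** This form absorbs error terms of order ln n, thanks to [ln_nat_le]. *)
Lemma cvg_of_linear_bounds (u : nat -> R) (l : R) :
  (forall e, 0 < e -> exists C, forall n,
     n.+1%:R * (l - e) - C <= u n.+1 <= n.+1%:R * (l + e) + C) ->
  n%:R^-1 * u n @[n --> \oo] --> l.
Proof.
move=> H; apply/cvgrPdist_le => e e0; have e2 : 0 < e / 2 by rewrite divr_gt0.
have [C HC] := H _ e2; near=> n.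
have n0 : (0 < n)%N by near: n; exact: nbhs_infty_gt.
have nR : (0 : R) < n%:R by rewrite ltr0n.
have Cn : C <= n%:R * (e / 2).
  by rewrite -ler_pdivrMr //; near: n; exact: nbhs_infty_ger.
have := HC n.-1; rewrite prednK // => /andP[h1 h2].
rewrite ler_distlC mulrC ler_pdivlMr // ler_pdivrMr //; apply/andP; split; lra.
Unshelve. all: end_near. Qed.

Lemma ln_nat_le (d : R) n : 0 < d -> ln n.+1%:R <= n.+1%:R * d - ln d :> R.
Proof.
move=> d0; have n0 : (0 : R) < n.+1%:R by rewrite ltr0n.
have := @ln_sublinear R (n.+1%:R * d) (mulr_gt0 n0 d0).
by rewrite lnM ?posrE //; lra.
Qed.

Lemma cvg_ln_partition_function a (beta : R) (H : R -> R) : 0 < beta ->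
  let g := tilt a beta in
  (forall u, - (g / 2) <= u <= g / 2 -> is_derive u 1 H (softplus u)) ->
  n%:R^-1 * ln (partition_function beta a n) @[n --> \oo] -->
    2 * ((H (g / 2) - H (- (g / 2))) / g).
Proof.
move=> b0 g dH; have g0 : 0 < g by rewrite /g; case: (a); rewrite //= mulr_gt0.
set l := (_ - _) / g; apply: cvg_of_linear_bounds => e e0.
have up n : (0 < n)%N -> softplus_sum g n <= n%:R * l.
  move=> n0; have /andP[h _] := softplus_sum_riemann g0 n0 dH.
  by rewrite /l mulrA ler_pdivlMr // [leLHS]mulrC.
have low n : (0 < n)%N -> n%:R * l - softplus (g / 2) <= softplus_sum g n.
  move=> n0; have /andP[_ h] := softplus_sum_riemann g0 n0 dH.
  by rewrite lerBlDr /l mulrA ler_pdivrMr // [leRHS]mulrC.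
exists (g / 2 + 2 * softplus (g / 2) + 2 * softplus (- (g / 2)) + 2 * `|ln (e / 2)|) => n.
have s0 := softplus_ge0 (g / 2); have s1 := softplus_ge0 (- (g / 2)).
have n0 : (0 : R) < n.+1%:R by rewrite ltr0n.
have ln0 := ler_norm (- ln (e / 2)); rewrite normrN in ln0.
have ne : 0 < n.+1%:R * e by rewrite mulr_gt0.
apply/andP; split.
  apply: le_trans (ln_partition_function_ge a n (ltW b0)).
  have := low n.+1 isT; have := @ln_nat_le (e / 2) n; rewrite -/g => /(_ ltac:(lra)); nra.
have : ln (partition_function beta a n.+1) <= n.+1%:R * (2 * l) + g / 2.
  move: @g {dH g0} @l up {low s0 s1}; case: a => g l up.
  - apply: (le_trans (ln_partition_function231_le _ _)).
    have := up (2 * n.+1)%N isT; rewrite natrM -/g; have : 0 <= g by rewrite mulr_ge0 ?ltW.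
    lra.
  - apply: (le_trans (ln_partition_function321_le _ _)).
    by have := up n.+1 isT; rewrite /g /=; lra.
have := normr_ge0 (ln (e / 2)); lra.
Qed.

(** Jensen's inequality for the uniform distribution on the avoiding
    permutations; m is the mean of the inversion number over n. *)
Lemma partition_function_jensen a n : exists m : R, forall beta,
  ln (partition_function 0 a n) + beta * m <= ln (partition_function beta a n).
Proof.
pose X (s : 'S_n) : R := n%:R^-1 * (inversions s)%:R.
have ZE beta : partition_function beta a n = \sum_(s : 'S_n | avoids a s) expR (beta * X s).
  by apply: eq_bigr => s _; rewrite mulrA.
have Z0 : 0 < partition_function (0 : R) a n := partition_function_gt0 _ _ _.
pose m := (\sum_(s : 'S_n | avoids a s) X s) / partition_function 0 a n.
exists m => beta; rewrite -[beta * m]expRK -lnM ?posrE ?expR_gt0 //.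
rewrite ler_ln ?posrE ?mulr_gt0 ?expR_gt0 ?partition_function_gt0 // mulrC [leRHS]ZE.
have -> : expR (beta * m) * partition_function 0 a n =
    \sum_(s : 'S_n | avoids a s) expR (beta * m) * (1 + beta * (X s - m)).
  have E0 : \sum_(s : 'S_n | avoids a s) 1 = partition_function 0 a n :> R.
    by rewrite ZE; apply: eq_bigr => s _; rewrite mul0r expR0.
  have Em : \sum_(s : 'S_n | avoids a s) m = m * partition_function 0 a n.
    by rewrite -E0 mulr_sumr; apply: eq_bigr => s _; rewrite mulr1.
  rewrite -mulr_sumr big_split /= E0 -mulr_sumr sumrB Em.
  by rewrite /m divfK ?gt_eqF // subrr mulr0 addr0.
apply: ler_sum => s _.
have -> : beta * X s = beta * m + beta * (X s - m) by ring.
by rewrite expRD ler_wpM2l ?expR_ge0 // expR_ge1Dx.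
Qed.

(** By convexity, the value at -b lies above the line through the values at 0
    and t. *)
Lemma partition_function_tangent a n (b t : R) : 0 <= b -> 0 < t ->
  (1 + b / t) * ln (partition_function 0 a n) - b / t * ln (partition_function t a n) <=
  ln (partition_function (- b) a n).
Proof.
move=> b0 t0; have [m mP] := partition_function_jensen a n.
apply: le_trans (mP (- b)); have := ler_wpM2l (divr_ge0 b0 (ltW t0)) (mP t).
have -> : b / t * (ln (partition_function 0 a n) + t * m) =
  b / t * ln (partition_function 0 a n) + b * m by field; rewrite gt_eqF.
lra.
Qed.

Lemma partition_function_le0 a n (beta : R) : beta <= 0 ->
  partition_function beta a n <= partition_function 0 a n.
Proof.
move=> b0; apply: ler_sum => s _; rewrite ler_expR !mul0r.
by rewrite mulr_le0_ge0 ?mulr_le0_ge0.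
Qed.

Lemma ln_partition_function_le_quadratic a n (t : R) : 0 <= t <= 2^-1 ->
  ln (partition_function t a n.+1) <= n.+1%:R * (2 * ln 2 + 8 * t ^+ 2) + t / 2.
Proof.
move=> /andP[t0 t1]; have n0 : (0 : R) < n.+1%:R by rewrite ltr0n.
have tt := sqr_ge0 t.
case: a.
- apply: (le_trans (ln_partition_function231_le _ _)).
  have := @softplus_sum_le_quadratic R (2 * t) (2 * n.+1) _ isT.
  rewrite natrM exprMn => /(_ ltac:(lra)); set S := softplus_sum _ _; nra.
- apply: (le_trans (ln_partition_function321_le _ _)).
  have := @softplus_sum_le_quadratic R t n.+1 _ isT.
  move=> /(_ ltac:(lra)); set S := softplus_sum _ _; nra.
Qed.

(** The slope of the secant between 0 and t is at most of order t, so choosing t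
    of order e / b makes its contribution at -b smaller than e. *)
Lemma cvg_ln_partition_function_le0 a (beta : R) : beta <= 0 ->
  n%:R^-1 * ln (partition_function beta a n) @[n --> \oo] --> (ln 4 : R).
Proof.
move=> b0; have ln4 : ln 4 = 2 * ln 2 :> R.
  by rewrite (_ : 4 = 2 ^+ 2 :> R) ?lnXn ?mulr_natl //; ring.
have [b [bE b_ge0]] : exists b, beta = - b /\ 0 <= b.
  by exists (- beta); rewrite opprK oppr_ge0.
rewrite ln4; apply: cvg_of_linear_bounds => e e0.
pose t := Num.min 2^-1 (e / (16 * (b + 1))).
have b1 : 0 < 16 * (b + 1) by lra.
have t0 : 0 < t by rewrite lt_min divr_gt0 ?andbT //; lra.
have t2 : t <= 2^-1 by rewrite ge_min lexx.
have te : t * (16 * (b + 1)) <= e by rewrite -ler_pdivlMr // ge_min lexx orbT.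
pose K := 1 + b / t; have K1 : 1 <= K by rewrite lerDl divr_ge0 // ltW.
have K0 : 0 < K by lra.
pose d := e / (4 * K); have d0 : 0 < d by rewrite divr_gt0 //; lra.
exists (K * (2 * ln 2 + 2 * `|ln d|) + b) => n.
have n0 : (0 : R) < n.+1%:R by rewrite ltr0n.
have ln2 : 0 <= ln 2 :> R by rewrite ln_ge0 // ler1n.
have lnd := ler_norm (- ln d); rewrite normrN in lnd.
have ne : 0 < n.+1%:R * e by rewrite mulr_gt0.
apply/andP; split; last first.
  have := ln_partition_function_le_quadratic a n (t := 0); rewrite lexx expr0n /=.
  move=> /(_ ltac:(lra)) h.
  have : ln (partition_function beta a n.+1) <= ln (partition_function 0 a n.+1).
    by rewrite ler_ln ?posrE ?partition_function_gt0 // partition_function_le0.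
  have : 0 <= K * (2 * ln 2 + 2 * `|ln d|).
    by rewrite mulr_ge0 ?(ltW K0) //; have := normr_ge0 (ln d); lra.
  lra.
rewrite bE; apply: le_trans (partition_function_tangent a n.+1 b_ge0 t0); rewrite -/K.
have bt : 0 <= b / t by rewrite divr_ge0 // ltW.
have lowK : K * (n.+1%:R * (2 * ln 2) - 2 * ln 2 - 2 * (n.+1%:R * d + `|ln d|)) <=
    K * ln (partition_function 0 a n.+1).
  rewrite ler_wpM2l ?(ltW K0) //.
  apply: le_trans (ln_partition_function_ge a n (lexx 0)).
  have -> : tilt a 0 = 0 :> R by case: a; rewrite /= ?mulr0.
  rewrite softplus_sum0 mul0r oppr0.
  have -> : softplus 0 = ln 2 :> R by rewrite /softplus expR0.
  by have := ln_nat_le n d0; lra.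
have upt : b / t * ln (partition_function t a n.+1) <=
    b / t * (n.+1%:R * (2 * ln 2)) + n.+1%:R * (8 * (b * t)) + b / 2.
  apply: le_trans (ler_wpM2l bt (ln_partition_function_le_quadratic a n _)) _; first by rewrite ltW.
  by rewrite le_eqVlt; apply/orP; left; apply/eqP; field; rewrite gt_eqF.
have Kd : K * d = e / 4 by rewrite /d; field; rewrite gt_eqF.
have btK : b / t = K - 1 by rewrite /K addrC addKr.
have bte : n.+1%:R * (8 * (b * t)) <= n.+1%:R * (e / 2).
  by rewrite ler_wpM2l ?(ltW n0) //; nra.
rewrite btK in upt *.
have : K * (n.+1%:R * (2 * ln 2) - 2 * ln 2 - 2 * (n.+1%:R * d + `|ln d|)) =
  K * (n.+1%:R * (2 * ln 2)) - K * (2 * ln 2 + 2 * `|ln d|) - 2 * n.+1%:R * (K * d) by ring.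
rewrite Kd => KE; rewrite KE in lowK; lra.
Qed.

End Limits.

Theorem proposition8 (R : realType) :
  (forall beta : R, 0 < beta ->
     (n%:R^-1 * ln (partition_function beta pat231 n) @[n --> \oo] -->
        2 * ln (1 + expR beta) - beta
        - beta^-1 * \int[lebesgue_measure]_(y in `[expR (- beta), expR beta])
                       (ln y / (1 + y)))
     /\
     (n%:R^-1 * ln (partition_function beta pat321 n) @[n --> \oo] -->
        2 / beta * \int[lebesgue_measure]_(y in `[expR (- (beta / 2)),
                                                  expR (beta / 2)])
                       (ln (1 + y) / y)))
  /\
  (forall beta : R, beta <= 0 ->
     (n%:R^-1 * ln (partition_function beta pat231 n) @[n --> \oo] -->
        (ln 4 : R))
     /\
     (n%:R^-1 * ln (partition_function beta pat321 n) @[n --> \oo] -->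
        (ln 4 : R))).
Proof.
split=> beta b0; last by split; exact: cvg_ln_partition_function_le0.
split.
- have [H dH HE] := exists_primitive_softplus231 b0.
  have g2 : 2 * beta / 2 = beta by field.
  have := @cvg_ln_partition_function R pat231 beta H b0; rewrite /= g2 => /(_ dH).
  rewrite -HE; set I := (X in _ - X); set L := (X in _ --> X -> _).
  suff -> : L = 2 * ln (1 + expR beta) - beta - beta^-1 * I by [].
  by rewrite /L /softplus; field; rewrite gt_eqF.
- have [H dH HE] := exists_primitive_softplus321 b0.
  have := @cvg_ln_partition_function R pat321 beta H b0; rewrite /= => /(_ dH).
  by rewrite -HE mulrA mulrAC.
Qed.
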